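(* There are constants $c$ and $n_0$ such that for all $n\ge n_0$, all integers $h\ge0$ and every surface $S$ of Euler genus $h$, the number of $n$-vertex simple maps in $S$ is at most $c^{n+h}h^h$.
   Context: A map is a connected pseudograph (loops and multiple edges allowed) cellularly embedded in a surface, considered as an unlabelled, unrooted object (up to isomorphism of embedded graphs). A map is simple if its underlying pseudograph is a simple graph, and $n$-vertex if it has $n$ vertices. Convention $0^0=1$. *)

(* Defs.v *)
From mathcomp Require Import all_boot all_fingroup.
Set Implicit Arguments.
Unset Strict Implicit.
Unset Printing Implicit Defensive.

Local Open Scope group_scope.

(* A map with m edges is encoded on the set of 4m flags 'I_(4*m) by three
   permutations (a0, a1, a2): fixed-point-free involutions with a0 a2 = a2 a0
   a fixed-point-free involution, and a transitive monodromy group.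
   vertices = orbits of <a1,a2>, edges = orbits of <a0,a2>,
   faces = orbits of <a0,a1>. *)
Section Maps.
Variable m : nat.
Local Notation F := 'I_(4 * m).

Definition triple := ({perm F} * {perm F} * {perm F})%type.
Definition al0 (t : triple) : {perm F} := t.1.1.
Definition al1 (t : triple) : {perm F} := t.1.2.
Definition al2 (t : triple) : {perm F} := t.2.

Definition fpf_involution (p : {perm F}) : bool :=
  (p * p == 1) && [forall x, p x != x].

Definition is_map (t : triple) : bool :=
  [&& fpf_involution (al0 t), fpf_involution (al1 t), fpf_involution (al2 t),
      al0 t * al2 t == al2 t * al0 t,
      [forall x, al0 t (al2 t x) != x] &
      [transitive <<[set al0 t; al1 t; al2 t]>>, on [set: F] | 'P]].

Definition vertex_of (t : triple) (x : F) : {set F} :=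
  orbit 'P <<[set al1 t; al2 t]>> x.
Definition edge_of (t : triple) (x : F) : {set F} :=
  orbit 'P <<[set al0 t; al2 t]>> x.
Definition face_of (t : triple) (x : F) : {set F} :=
  orbit 'P <<[set al0 t; al1 t]>> x.

Definition nverts (t : triple) : nat := #|[set vertex_of t x | x : F]|.
Definition nedges (t : triple) : nat := #|[set edge_of t x | x : F]|.
Definition nfaces (t : triple) : nat := #|[set face_of t x | x : F]|.

(* Euler genus h: V - E + F = 2 - h, written without subtraction. *)
Definition has_euler_genus (t : triple) (h : nat) : bool :=
  nverts t + nfaces t + h == 2 + nedges t.

(* For a connected map: orientable iff the even-word subgroup
   <a0 a1, a1 a2> has exactly two orbits on flags. *)
Definition orientable (t : triple) : bool :=
  #|[set orbit 'P <<[set al0 t * al1 t; al1 t * al2 t]>> x | x : F]| == 2.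

Definition simple_map (t : triple) : bool :=
  [forall x, vertex_of t x != vertex_of t (al0 t x)] &&
  [forall x, forall y,
     ([set vertex_of t x; vertex_of t (al0 t x)] ==
      [set vertex_of t y; vertex_of t (al0 t y)]) ==> (edge_of t x == edge_of t y)].

Definition map_iso (t u : triple) : bool :=
  [exists s : {perm F}, u == (al0 t ^ s, al1 t ^ s, al2 t ^ s)].

Definition simple_maps_in (n h : nat) (o : bool) : {set triple} :=
  [set t | [&& is_map t, simple_map t, nverts t == n,
              has_euler_genus t h & orientable t == o]].

Definition iso_classes (n h : nat) (o : bool) : {set {set triple}} :=
  [set [set u | map_iso t u] | t in simple_maps_in n h o].

End Maps.

(* A (closed) surface is determined by its Euler genus h and orientability:
   orientable surfaces have even Euler genus, non-orientable ones h >= 1. *)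
Definition surface_exists (h : nat) (o : bool) : bool :=
  if o then ~~ odd h else 0 < h.

(* Number of unlabelled n-vertex simple maps in the surface (h, o).  A simple
   graph on n vertices has at most 'C(n,2) edges, so summing over edge counts
   m <= 'C(n,2) counts all of them. *)
Definition num_simple_maps (n h : nat) (o : bool) : nat :=
  \sum_(m < 'C(n, 2).+1) #|iso_classes m n h o|.

(* Main.v *)
(** The idea is to cut a map with [n] vertices, [f] faces and [m] edges along a
    spanning tree [T] and a spanning tree [S] of the dual that avoids [T].  By
    Euler's formula exactly [h] edges lie outside [T] and [S].  Walking around [T]
    is a single cycle through all flags, and the two sides of every edge of [T] are
    joined by chords of that cycle that do not cross, so the edges of [T] are
    encoded by a parenthesis word.  Crossing [T] and the [h] remaining edges instead
    is again a single cycle, on which the edges of [S] are a parenthesis word.  The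
    remaining edges cost [O(h)^h].  Hence at most [C^m (4h+1)^h] maps have [m] edges,
    and simplicity bounds [m] linearly in [n + h]. *)

Require Import Defs.
From mathcomp Require Import all_boot all_fingroup.
From mathcomp Require Import zify.
Set Implicit Arguments.
Unset Strict Implicit.
Unset Printing Implicit Defensive.

(** On [A] the map [f] factors through [g]: choose a preimage of each value of [g]. In the final
    count [f] is the isomorphism class and [g] the code. *)
Lemma leq_card_imset_factor (D : finType) (U V : finType) (A : {pred D})
    (f : D -> U) (g : D -> V) :
  {in A &, forall x y, g x = g y -> f x = f y} -> #|f @: A| <= #|g @: A|.
Proof.
move=> gf.
case: (pickP (mem A)) => [a aA|A0]; last first.
  suff -> : f @: A = set0 by rewrite cards0.
  by apply/setP => y; rewrite inE; apply/imsetP => -[x]; rewrite -[_ \in A]/(mem A x) A0.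
pose k c := odflt a [pick x in A | g x == c].
have -> : f @: A = (f \o k) @: (g @: A).
  rewrite -imset_comp; apply: eq_in_imset => x xA /=; apply: gf => //.
    by rewrite /k; case: pickP => //= y /andP[].
  rewrite /k; case: pickP => [y /andP[_ /eqP->]//|/(_ x)].
  by rewrite /= xA eqxx.
exact: leq_imset_card.
Qed.

(** * Alternating walks *)

Fixpoint walk (F : finType) (p b : F -> F) (x0 : F) k :=
  if k is k'.+1 then (if odd k' then b else p) (walk p b x0 k') else x0.

Definition step2 (F : finType) (p b : F -> F) : rel F :=
  [rel x y | (y == p x) || (y == b x)].

Definition pos (F : finType) (p b : F -> F) (x0 x : F) :=
  index x (mkseq (walk p b x0) #|F|).

Section Walk.
Variables (F : finType) (p b : F -> F) (x0 : F).
Hypotheses (pK : involutive p) (bK : involutive b).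
Hypotheses (p_fpf : forall x, p x != x) (b_fpf : forall x, b x != x).

Notation w := (walk p b x0).

Lemma walk_p k : p (w k) = w (if odd k then k.-1 else k.+1).
Proof. by case: k => [|k] //=; case o: (odd k) => /=; rewrite ?o ?pK. Qed.

Lemma walk_b k : 0 < k -> b (w k) = w (if odd k then k.+1 else k.-1).
Proof. by case: k => [|k] // _ /=; case o: (odd k) => /=; rewrite ?o ?bK. Qed.

(** If the parities differed, the step leaving [w i] and the step entering [w j] would be the same
    involution, so [w i.+1 = w j.-1]. Shrinking the interval in this way ends at a fixed point of
    [p] or [b]. *)
Lemma walk_odd i j : i < j -> w i = w j -> odd i = odd j.
Proof.
move: {2}(j - i) (leqnn (j - i)) => d; elim: d i j => [|d IH] i j dij ij E.
  by lia.
have [//|odd_ne] := eqVneq (odd i) (odd j).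
have E1 : w i.+1 = w j.-1.
  case: j ij E odd_ne {dij} => [|j] // ij E odd_ne.
  rewrite [w i.+1]/= E [w j.+1]/=.
  have -> : odd i = odd j by move: odd_ne => /=; case: (odd i); case: (odd j).
  by case: (odd j); rewrite ?pK ?bK.
have [e|/eqP ne] := eqVneq j i.+1.
  subst j; move: E => /=; case: (odd i) => E.
    by have := b_fpf (w i); rewrite -E eqxx.
  by have := p_fpf (w i); rewrite -E eqxx.
have o' : odd j.-1 = ~~ odd j by case: (j) ij => [|j'] //= _; rewrite negbK.
have [e|/eqP ne2] := eqVneq i.+1 j.-1.
  by have := congr1 odd e; rewrite o' /=; case: (odd i) (odd j) odd_ne => [] [].
have := IH i.+1 j.-1 _ _ E1; rewrite o' /= => H.
by have := H ltac:(lia) ltac:(lia); case: (odd i) (odd j) => [] [].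
Qed.

Lemma walk_shift i d : 0 < d -> w i = w (i + d) -> w d = x0.
Proof.
move=> d0; elim: i => [|i IH] E; first by rewrite -E.
have o : odd i.+1 = odd (i.+1 + d) by apply: walk_odd E; lia.
apply: IH; move: E o; rewrite addSn /= => E /negb_inj o; move: E.
by rewrite -o; case: (odd i); [move/(can_inj bK)|move/(can_inj pK)].
Qed.

(** The pigeonhole principle gives a return to [x0]. The least return time [K] is even by
    [walk_odd], and an earlier coincidence would shift to an earlier return. *)
Lemma walk_period : exists K, [/\ 0 < K <= #|F|, ~~ odd K, w K = x0 &
  forall i j, i < K -> j < K -> w i = w j -> i = j].
Proof.
have shift i j : i < j -> w i = w j -> w (j - i) = x0.
  move=> ij E; apply: (@walk_shift i); first by lia.
  by rewrite subnKC //; lia.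
have exK : exists K, (0 < K <= #|F|) && (w K == x0).
  have /injectivePn[i [j ne E]] : ~~ injectiveb (fun i : 'I_#|F|.+1 => w i).
    by apply/negP => /injectiveP /leq_card; rewrite card_ord ltnn.
  wlog ij : i j ne E / i < j.
    move=> H; case: (ltngtP i j) => [ij|ij|/val_inj eij];
      [exact: (H i j) | | by rewrite eij eqxx in ne].
    by apply: (H j i) => //; rewrite eq_sym.
  exists (j - i); rewrite shift // eqxx; have := ltn_ord j; lia.
case: (ex_minnP exK) => K /andP[K0 /eqP wK] Kmin; exists K; split=> //.
  by rewrite -(@walk_odd 0 K) //; lia.
suff lt i j : i < j -> j < K -> w i <> w j.
  move=> i j iK jK E; case: (ltngtP i j) => // ij.
    by case: (lt i j).
  by case: (lt j i).
move=> ij jK /(shift _ _ ij) E.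
have : K <= j - i by apply: Kmin; rewrite E eqxx; lia.
lia.
Qed.

Lemma walkD_period K k : ~~ odd K -> w K = x0 -> w (K + k) = w k.
Proof.
move=> oK wK; elim: k => [|k IH]; first by rewrite addn0.
by rewrite addnS /= IH oddD (negPf oK).
Qed.

Lemma walk_last K : 0 < K -> ~~ odd K -> w K = x0 -> b x0 = w K.-1.
Proof. by move=> K0 oK wK; rewrite -{1}wK walk_b // (negPf oK). Qed.

Lemma connect_p x : connect (step2 p b) x (p x).
Proof. by apply: connect1; rewrite /step2 /= eqxx. Qed.

Lemma connect_b x : connect (step2 p b) x (b x).
Proof. by apply: connect1; rewrite /step2 /= eqxx orbT. Qed.

Lemma connect_walk k : connect (step2 p b) x0 (w k).
Proof.
elim: k => [|k IH] //=; apply: connect_trans IH _.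
by case: ifP => _; [apply: connect_b | apply: connect_p].
Qed.

(* A cycle of alternating steps stays connected after removing one edge. *)
Lemma connect_bypass (b' : F -> F) :
  (forall x, connect (step2 p b) x0 x -> x != x0 -> x != b x0 -> b' x = b x) ->
  connect (step2 p b') x0 (b x0).
Proof.
move=> b'E; have [K [/andP[K0 _] oK wK inj]] := walk_period.
rewrite (walk_last K0 oK wK).
have: K.-1 < K by lia.
elim: {-2}K.-1 (leqnn K.-1) => [|k IH] kK1 kK; first exact: connect0.
have kK' : k < K by lia.
apply: connect_trans (IH _ kK') _; first by lia.
rewrite [w k.+1]/=; case: ifP => ok; last by apply: connect1; rewrite /step2 /= eqxx.
rewrite -b'E; first by apply: connect1; rewrite /step2 /= eqxx orbT.
- exact: connect_walk.
- by apply/eqP => /(inj k 0 kK' K0) k0; rewrite k0 in ok.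
- apply/eqP; rewrite (walk_last K0 oK wK) => /(inj _ _ kK') E.
  by have := E ltac:(lia); lia.
Qed.

Hypothesis conn : forall x, connect (step2 p b) x0 x.

(** The cycle of [walk_period] is closed under [p] and [b], so connectedness makes it run through
    all of [F]. *)
Lemma walk_full : [/\ ~~ odd #|F|, w #|F| = x0,
  forall x, exists2 k, k < #|F| & w k = x &
  forall i j, i < #|F| -> j < #|F| -> w i = w j -> i = j].
Proof.
have [K [/andP[K0 KF] oK wK Kinj]] := walk_period.
have onto x : exists2 k, k < K & w k = x.
  have /connectP[s ps ->] := conn x.
  elim/last_ind: s ps => [|s y IH]; first by exists 0.
  rewrite rcons_path last_rcons => /andP[/IH[k kK <-]] /orP[] /eqP->.
    rewrite walk_p; case: ifP => ok; eexists; try reflexivity; first by lia.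
    rewrite ltn_neqAle kK andbT; apply/eqP => E.
    by move: oK; rewrite -E /= ok.
  case: (posnP k) => [->|k0].
    by exists K.-1; [lia | rewrite -walk_last].
  rewrite walk_b //; case: ifP => ok; last by eexists; try reflexivity; lia.
  have [E|ne] := eqVneq k.+1 K; last by exists k.+1 => //; lia.
  by exists 0; rewrite // E.
suff e : K = #|F| by rewrite -e.
apply/eqP; rewrite eqn_leq KF -[leqRHS]card_ord /=.
pose f (k : 'I_K) := w k.
rewrite -cardsT; have -> : [set: F] = f @: 'I_K.
  apply/setP => x; rewrite inE; have [k kK <-] := onto x.
  by symmetry; apply/imsetP; exists (Ordinal kK).
exact: leq_imset_card.
Qed.

Lemma pos_lt x : pos p b x0 x < #|F|.
Proof.
have [_ _ onto _] := walk_full.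
have [k kF <-] := onto x; rewrite /pos -[X in _ < X](size_mkseq w) index_mem.
by apply/mapP; exists k => //; rewrite mem_iota.
Qed.

Lemma posK x : w (pos p b x0 x) = x.
Proof.
have lt := pos_lt x; rewrite -(nth_mkseq x0 w lt) nth_index //.
by rewrite -index_mem size_mkseq.
Qed.

Lemma walkK k : k < #|F| -> pos p b x0 (w k) = k.
Proof.
have [_ _ _ inj] := walk_full.
by move=> kF; apply: inj; rewrite ?posK // pos_lt.
Qed.

End Walk.

(** * Connected components *)

Section Components.
Variable F : finType.
Implicit Types e : rel F.

Definition component e x := [set y | connect e x y].
Definition ncomp e := #|[set component e x | x : F]|.

Lemma component_eqP e x y : connect_sym e ->
  reflect (component e x = component e y) (connect e x y).
Proof.
move=> e_sym; apply: (iffP idP) => [exy | E].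
  by apply/setP => z; rewrite !inE (same_connect e_sym exy).
by have : y \in component e x; [rewrite E inE connect0 | rewrite inE].
Qed.

(** The function [f] merges the class of [v] into that of [u]. It is constant on the classes of
    [e'], and its values miss at most one class of [e]. *)
Lemma ncomp_merge e e' u v : connect_sym e ->
  (forall x y, e' x y -> [|| connect e x y, connect e u x && connect e v y
                           | connect e v x && connect e u y]) ->
  connect_sym e' -> ncomp e <= (ncomp e').+1.
Proof.
move=> e_sym sub e'_sym.
pose f x := if connect e v x then component e u else component e x.
have f_inv x y : connect e' x y -> f x = f y.
  move=> /connectP[s ps ->] {y}; elim: s x ps => [|y s IH] x //= /andP[xy /IH <-].
  have fu z : connect e u z -> f z = component e u.
    by rewrite /f => uz; case: ifP => // _; symmetry; apply/component_eqP.
  have fv z : connect e v z -> f z = component e u by rewrite /f => ->.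
  case/or3P: (sub x y xy) => [exy|/andP[ux vy]|/andP[vx uy]].
  - rewrite /f -(same_connect_r e_sym exy); case: ifP => // _.
    exact/component_eqP.
  - by rewrite (fu x) // (fv y).
  - by rewrite (fv x) // (fu y).
apply: leq_trans (_ : #|component e v |: [set f x | x : F]| <= _).
  apply/subset_leq_card/subsetP => C /imsetP[x _ ->].
  have [vx|nvx] := boolP (connect e v x).
    by rewrite inE; apply/orP; left; rewrite inE; apply/eqP; symmetry; apply/component_eqP.
  rewrite inE; apply/orP; right; apply/imsetP; exists x => //.
  by rewrite /f (negPf nvx).
apply: leq_trans (_ : (#|[set f x | x : F]|).+1 <= _).
  by rewrite cardsU1 -add1n leq_add2r leq_b1.
rewrite ltnS; apply: leq_card_imset_factor => x y _ _.
by move/component_eqP => /(_ e'_sym) /f_inv.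
Qed.

End Components.

(** * Spanning trees of flag systems *)

Section Forest.
Variable F : finType.
Implicit Types (p q r : F -> F) (A B : {set F}).

(* For a map this is used with [(p, q, r) = (a1, a2, a0)], and for its dual with
   [(p, q, r) = (a1, a0, a2)]. *)
Record flag_system p q r : Prop := FlagSystem {
  fsK0 : involutive p;
  fsK1 : involutive q;
  fsK2 : involutive r;
  fsC : forall x, q (r x) = r (q x);
  fs_fpf0 : forall x, p x != x;
  fs_fpf1 : forall x, q x != x;
  fs_fpf2 : forall x, r x != x;
  fs_fpf12 : forall x, q (r x) != x }.

Definition edge q r u : {set F} := [set u; q u; r u; q (r u)].
Definition eclosed q r A := [forall x in A, (q x \in A) && (r x \in A)].
(* The alternating walk with steps [p] and [cross q r A] follows the boundary of a
   thickening of the subgraph [A]. *)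
Definition cross q r A x := if x \in A then r x else q x.
(* The components of [step3] are those of the subgraph [A]: [p] and [q] turn around a
   vertex and [r] runs along an edge. *)
Definition step3 p q r A : rel F :=
  [rel x y | [|| y == p x, y == q x | (x \in A) && (y == r x)]].
(** For a union of edges [A] this says that the subgraph is a forest. *)
Definition bridges p q r A :=
  forall u, u \in A -> ~~ connect (step3 p q r (A :\: edge q r u)) u (r u).

(** Exchanging [q] and [r] passes to the dual map. *)
Lemma flag_system_swap p q r : flag_system p q r -> flag_system p r q.
Proof. by case=> pK qK rK C p0 q0 r0 qr0; split=> // x; rewrite -C. Qed.

Variables p q r : F -> F.
Hypothesis fs : flag_system p q r.
Let qK := fsK1 fs.
Let rK := fsK2 fs.
Let qr := fsC fs.

Lemma eclosedP A : reflect (forall x, ((q x \in A) = (x \in A)) /\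
                                      ((r x \in A) = (x \in A))) (eclosed q r A).
Proof.
apply: (iffP forallP) => [H x | H x]; last first.
  by have [-> ->] := H x; rewrite andbb; apply/implyP.
have {}H y : y \in A -> (q y \in A) /\ (r y \in A).
  by move=> yA; apply/andP; move: (H y); rewrite yA.
split; apply/idP/idP => [/H | /H []//].
  by rewrite qK => -[].
by rewrite rK => -[].
Qed.

Lemma eclosed_edge u : eclosed q r (edge q r u).
Proof.
apply/forallP => x; apply/implyP; rewrite !inE -!orbA.
by case/or4P=> /eqP->; rewrite ?rK ?qK -?qr ?rK ?qK ?eqxx ?orbT // qr rK eqxx ?orbT.
Qed.

Lemma eclosedD A B : eclosed q r A -> eclosed q r B -> eclosed q r (A :\: B).
Proof.
move=> /eclosedP cA /eclosedP cB; apply/eclosedP => x.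
by have [a1 a2] := cA x; have [b1 b2] := cB x; rewrite !inE a1 a2 b1 b2.
Qed.

Lemma eclosedC A : eclosed q r A -> eclosed q r (~: A).
Proof.
by move=> /eclosedP cA; apply/eclosedP => x; have [a1 a2] := cA x; rewrite !inE a1 a2.
Qed.

Lemma edge_id u : u \in edge q r u.
Proof. by rewrite !inE eqxx. Qed.

Lemma edge_sub A u : eclosed q r A -> u \in A -> edge q r u \subset A.
Proof.
move=> /eclosedP cA uA; apply/subsetP => x; rewrite !inE -!orbA.
by case/or4P=> /eqP->; have [a1 a2] := cA u; have [a3 _] := cA (r u); rewrite ?a3 ?a1 ?a2.
Qed.

Lemma card_edge u : #|edge q r u| = 4.
Proof.
have [[n0 n1] n2] := (fs_fpf1 fs, fs_fpf2 fs, fs_fpf12 fs).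
have E : edge q r u = u |: (q u |: (r u |: [set q (r u)])).
  by apply/setP => x; rewrite !inE -!orbA.
rewrite E !cardsU1 cards1 !inE !negb_or (eq_sym u) n0 (eq_sym u) n1 (eq_sym u) n2.
rewrite (eq_sym (r u)) n0.
have -> : (q u != r u) = true.
  by apply/eqP => e; have := n2 u; rewrite -e qK eqxx.
by rewrite (inj_eq (can_inj qK)) eq_sym n1.
Qed.

Lemma edge_eq u v : v \in edge q r u -> edge q r v = edge q r u.
Proof.
move=> vu; apply/eqP; rewrite eqEcard !card_edge leqnn andbT.
by apply: edge_sub => //; apply: eclosed_edge.
Qed.

Lemma crossK A : eclosed q r A -> involutive (cross q r A).
Proof.
move=> /eclosedP cA x; rewrite /cross; have [a1 a2] := cA x.
by case xA: (x \in A); rewrite ?a1 ?a2 xA.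
Qed.

Lemma cross_fpf A x : cross q r A x != x.
Proof. by rewrite /cross; case: ifP => _; [apply: (fs_fpf2 fs) | apply: (fs_fpf1 fs)]. Qed.

Lemma step3_sym A : eclosed q r A -> connect_sym (step3 p q r A).
Proof.
move=> /eclosedP cA; apply: sym_connect_sym => x y; rewrite /step3 /=.
have inv f : involutive f -> (y == f x) = (x == f y).
  by move=> fK; rewrite eq_sym (inv_eq fK).
rewrite (inv _ (fsK0 fs)) (inv _ qK) (inv _ rK); congr [|| _, _ | _].
apply/andP/andP => -[zA /eqP e]; split; rewrite ?e //.
  by have [_] := cA y; rewrite -e zA.
by have [_ ->] := cA y.
Qed.

Lemma connect3_p A x : connect (step3 p q r A) x (p x).
Proof. by apply: connect1; rewrite /step3 /= eqxx. Qed.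

Lemma connect3_q A x : connect (step3 p q r A) x (q x).
Proof. by apply: connect1; rewrite /step3 /= eqxx orbT. Qed.

Lemma connect3_r A x : x \in A -> connect (step3 p q r A) x (r x).
Proof. by move=> xA; apply: connect1; rewrite /step3 /= xA eqxx !orbT. Qed.

Lemma connect3S A B : A \subset B -> subrel (connect (step3 p q r A)) (connect (step3 p q r B)).
Proof.
move=> /subsetP AB; apply: connect_sub => x y /or3P[||/andP[/AB xB]] /eqP->.
- exact: connect3_p.
- exact: connect3_q.
- exact: connect3_r.
Qed.

Lemma connect2_3 A : subrel (connect (step2 p (cross q r A))) (connect (step3 p q r A)).
Proof.
apply: connect_sub => x y /orP[] /eqP->; first exact: connect3_p.
by rewrite /cross; case: ifP => xA; [apply: connect3_r | apply: connect3_q].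
Qed.

Lemma bridgesS A B : B \subset A -> bridges p q r A -> bridges p q r B.
Proof.
move=> BA br u uB; apply: contra (br u (subsetP BA u uB)).
by apply: connect3S; apply: setSD.
Qed.

(** A thickened tree is a disc, so its boundary is one contour. The induction deletes one edge at a
    time; this removes four flags and creates at most one new component, whence the factors 4. *)
Lemma forest_components A : eclosed q r A -> bridges p q r A ->
  (forall x y, connect (step2 p (cross q r A)) x y = connect (step3 p q r A) x y) /\
  4 * ncomp (step3 p q r set0) <= 4 * ncomp (step3 p q r A) + #|A|.
Proof.
elim: {A}_.+1 {-2}A (ltnSn #|A|) => // n IH A An cA br.
have [->|/set0Pn[u uA]] := eqVneq A set0.
  split; last by rewrite leq_addr.
  move=> x y; apply/idP/idP; first exact: connect2_3.
  apply: connect_sub x y => x y; rewrite /step3 /= inE /= orbF => /orP[] /eqP->.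
    exact: connect_p.
  have -> : q x = cross q r set0 x by rewrite /cross inE.
  exact: connect_b.
pose E := edge q r u; pose B := A :\: E.
have EA : E \subset A by apply: edge_sub.
have cE : eclosed q r E by apply: eclosed_edge.
have cB : eclosed q r B by apply: eclosedD.
have BA : B \subset A by apply: subsetDl.
have cardA : #|A| = #|B| + 4.
  by rewrite -(cardsID E A) (setIidPr EA) card_edge addnC.
have [IHc IHn] : _ /\ _ := IH B ltac:(lia) cB (bridgesS BA br).
have nB : ~~ connect (step3 p q r B) u (r u) := br u uA.
have symB := step3_sym cB; have symA := step3_sym cA.
have uB x : x \in E -> x \notin B by rewrite !inE => ->.
(* When [v] and [r v] are separated, the contour of [v] around [B] meets the deleted edge only in
   [v] and [q v]. Without the step between these two it is a path that also follows the contour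
   steps of [A]. *)
have bypass v : v \in E -> ~~ connect (step3 p q r B) v (r v) ->
    connect (step2 p (cross q r A)) v (q v).
  move=> vE nv; have crv : cross q r B v = q v by rewrite /cross (negPf (uB v vE)).
  rewrite -crv; apply: connect_bypass.
  - exact: fsK0 fs.
  - exact: crossK.
  - exact: fs_fpf0 fs.
  - exact: cross_fpf.
  move=> x; rewrite IHc crv /cross => vx xv xqv.
  have xE : x \notin E.
    rewrite -[E](edge_eq vE) !inE !negb_or xv xqv /=; apply/andP; split; apply: contra nv.
      by move/eqP <-.
    move/eqP=> xE; apply: connect_trans vx _; rewrite xE -{2}(qK (r v)); exact: connect3_q.
  by rewrite in_setD xE.
have [ruE quE] : r u \in E /\ q u \in E by rewrite !inE !eqxx !orbT.
have conn_u : connect (step2 p (cross q r A)) u (q u).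
  by apply: bypass => //; apply: edge_id.
have conn_ru : connect (step2 p (cross q r A)) (r u) (q (r u)).
  by apply: bypass; rewrite // rK symB.
have sym2 : connect_sym (step2 p (cross q r A)).
  apply: sym_connect_sym => x y; rewrite /step2 /=.
  by rewrite 2!(eq_sym y) (inv_eq (fsK0 fs)) (inv_eq (crossK cA)) 2!(eq_sym x).
have conn_q x : x \in E -> connect (step2 p (cross q r A)) x (q x).
  rewrite !inE -!orbA => /or4P[] /eqP-> //; rewrite qK sym2 //.
have BinA x y : connect (step3 p q r B) x y -> connect (step2 p (cross q r A)) x y.
  rewrite -IHc; apply: connect_sub x y => x y /orP[] /eqP->; first exact: connect_p.
  have [xE|xE] := boolP (x \in E).
    by rewrite {2}/cross (negPf (uB x xE)) conn_q.
  have -> : cross q r B x = cross q r A x by rewrite /cross in_setD xE.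
  exact: connect_b.
split.
  move=> x y; apply/idP/idP; first exact: connect2_3.
  apply: connect_sub x y => x y /or3P[||/andP[xA]] /eqP->.
  - exact: connect_p.
  - exact/BinA/connect3_q.
  have -> : r x = cross q r A x by rewrite /cross xA.
  exact: connect_b.
(* Restoring the edge can merge only the components of [u] and [r u]. *)
have : ncomp (step3 p q r B) <= (ncomp (step3 p q r A)).+1.
  apply: (@ncomp_merge _ _ _ u (r u)) => // x y /or3P[||/andP[xA]] /eqP->.
  - by rewrite connect3_p.
  - by rewrite connect3_q.
  have [xE|xE] := boolP (x \in E); last first.
    by rewrite connect3_r // in_setD xE.
  move: xE; rewrite !inE -!orbA => /or4P[] /eqP->.
  - by rewrite !connect0 orbT.
  - by rewrite connect3_q -qr connect3_q orbT.
  - by rewrite !connect0 rK !connect0 !orbT.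
  - by rewrite connect3_q qr rK connect3_q !orbT.
by move: IHn; rewrite cardA; lia.
Qed.

End Forest.

Section Tree.
Variable F : finType.
Implicit Types (p q r : F -> F) (A B : {set F}).

(** Connectedness is asked of the contour steps, the form needed for walking around the tree; by
    [forest_components] it amounts to connectedness under [step3]. *)
Definition spanning_tree p q r A :=
  [/\ eclosed q r A, bridges p q r A &
      forall x y, connect (step2 p (cross q r A)) x y].

(** In a minimal connected union of edges inside [D] every edge is a bridge, since any other edge
    could be dropped. The inequality is four times the bound of the number of vertices by one plus
    the number of edges. *)
Lemma spanning_tree_exists p q r D : flag_system p q r -> eclosed q r D ->
  (forall x y, connect (step3 p q r D) x y) ->
  exists A, [/\ A \subset D, spanning_tree p q r A &
                4 * ncomp (step3 p q r set0) <= 4 + #|A|].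
Proof.
move=> fs cD connD.
pose P A := eclosed q r A && [forall x, forall y, connect (step3 p q r A) x y].
have PD : P D by rewrite /P cD /=; apply/forallP => x; apply/forallP => y.
have [A /minsetP[/andP[cA /forallP connA] Amin] AD] := minset_exists PD.
have {}connA x y : connect (step3 p q r A) x y by move/forallP: (connA x); apply.
have br : bridges p q r A.
  move=> u uA; apply/negP => conn_u.
  have cE := eclosed_edge fs u.
  have cB := eclosedD fs cA cE.
  have sym := step3_sym fs cB.
  have /Amin : P (A :\: edge q r u).
    rewrite /P cB /=; apply/forallP => x; apply/forallP => y.
    apply: connect_sub (connA x y) => {}x {}y /or3P[||/andP[xA]] /eqP->.
    - exact: connect3_p.
    - exact: connect3_q.
    have [xE|xE] := boolP (x \in edge q r u); last first.
      by apply: connect3_r; rewrite in_setD xE.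
    have qq z : connect (step3 p q r (A :\: edge q r u)) z (q z) by apply: connect3_q.
    move: xE; rewrite !inE -!orbA => /or4P[] /eqP-> //.
    - by rewrite -(fsC fs) sym (connect_trans _ (qq u)) // sym (connect_trans conn_u).
    - by rewrite (fsK2 fs) sym.
    - rewrite (fsC fs) (fsK2 fs) sym -(fsC fs); apply: connect_trans (qq _).
      by apply: connect_trans conn_u; rewrite sym.
  move/(_ (subsetDl _ _))/setP/(_ u); rewrite in_setD uA edge_id.
  by [].
have [E le] := forest_components fs cA br.
exists A; split=> //; first by split=> // x y; rewrite E.
apply: leq_trans le _; rewrite leq_add2r -[leqRHS]muln1 leq_mul2l /=.
rewrite /ncomp; apply: leq_trans (_ : #|[set (tt : unit) | _ : F]| <= _).
  apply: leq_card_imset_factor => x y _ _ _.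
  by apply/component_eqP => //; apply: step3_sym.
by rewrite (leq_trans (max_card _)) // card_unit.
Qed.

(** * Non-crossing chords *)

(** The pairs [z], [q z] in [A] are chords of the contour; the end met first from [x0] is an opening
    parenthesis. *)
Definition opener p q r A x0 z :=
  (z \in A) && (pos p (cross q r A) x0 z < pos p (cross q r A) x0 (q z)).

Section Chords.
Variables (p q r : F -> F) (A : {set F}) (x0 : F).
Hypotheses (fs : flag_system p q r) (trA : spanning_tree p q r A).
Let cA : eclosed q r A. Proof. by case: trA. Qed.
Let conn x y : connect (step2 p (cross q r A)) x y. Proof. by case: trA. Qed.
Let qK := fsK1 fs.
Let pK := fsK0 fs.
Let bK := crossK fs cA.
Let pf := fs_fpf0 fs.
Let bf := cross_fpf fs A.
Notation w := (walk p (cross q r A) x0).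
Notation ps := (pos p (cross q r A) x0).

Lemma tree_posK x : w (ps x) = x. Proof. exact: posK. Qed.
Lemma tree_pos_lt x : ps x < #|F|. Proof. exact: pos_lt. Qed.
Lemma tree_walkK k : k < #|F| -> ps (w k) = k. Proof. exact: walkK. Qed.
Let psK := tree_posK.
Let ps_lt := tree_pos_lt.
Let wK := tree_walkK.

(* Deleting the edge of [u] disconnects the tree; the indicator [J] of the side of [u]
   is invariant under [q] and, along the walk, changes only at that edge. *)
Lemma noncrossing u y : u \in A -> ps u < ps y < ps (q u) ->
  ps u < ps (q y) < ps (q u).
Proof.
move=> uA yin; apply/negPn/negP => qyout.
have [oN wN _ _] := walk_full pK bK pf bf (conn x0).
pose E := edge q r u; pose J z := connect (step3 p q r (A :\: E)) u z.
have cB : eclosed q r (A :\: E).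
  exact: (eclosedD fs cA (eclosed_edge fs u)).
have sym := step3_sym fs cB.
have Jp z : J (p z) = J z by apply: same_connect_r => //; rewrite sym connect3_p.
have Jq z : J (q z) = J z by apply: same_connect_r => //; rewrite sym connect3_q.
have Jr z : z \in A :\: E -> J (r z) = J z.
  by move=> zB; apply: same_connect_r => //; rewrite sym connect3_r.
have nJ : J (r u) = false by apply/negbTE; case: trA => _ /(_ u uA).
have step k : (w k != u) && (w k != q u) -> (w k.+1 != u) && (w k.+1 != q u) ->
    J (w k.+1) = J (w k).
  rewrite [w k.+1]/=; case: ifP => _; last by rewrite Jp.
  set z := walk _ _ _ k; rewrite /cross; case: ifP => wA; last by rewrite Jq.
  move=> /andP[nu nqu] /andP[ru rqu]; apply: Jr; rewrite in_setD wA andbT.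
  rewrite !inE !negb_or nu nqu; apply/andP; split.
    by apply: contra ru => /eqP->; rewrite (fsK2 fs).
  by apply: contra rqu => /eqP->; rewrite (fsC fs) (fsK2 fs).
have const s d : (forall k, s <= k <= s + d -> (w k != u) && (w k != q u)) ->
    J (w (s + d)) = J (w s).
  elim: d => [|d IH] H; first by rewrite addn0.
  by rewrite addnS step ?IH //; [move=> k ?|..]; apply: H; lia.
set i := ps u in yin qyout *; set j := ps (q u) in yin qyout *.
have iN : i < #|F| := ps_lt u.
have jN : j < #|F| := ps_lt (q u).
have w_ne k : k < #|F| -> k != i -> k != j -> (w k != u) && (w k != q u).
  by move=> kN ki kj; apply/andP; split; [apply: contra ki | apply: contra kj];
     move=> /eqP e; rewrite /i /j -e wK.
(* Between positions [i] and [j] the walk avoids [u] and [q u], so [J] is constant there. *)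
have inJ z : i < ps z < j -> J z = J y.
  move=> zin; suff C k : i < k < j -> J (w k) = J (w i.+1).
    by rewrite -(psK z) -(psK y) !C.
  move=> kin; have -> : k = i.+1 + (k - i.+1) by lia.
  by apply: const => l lin; apply: w_ne; lia.
have outJ z : z != u -> z != q u -> ~~ (i < ps z < j) -> J z = J (w j.+1).
  move=> zu zqu zout.
  have zi : ps z != i by apply: contra zu => /eqP e; rewrite -(psK z) e psK.
  have zj : ps z != j by apply: contra zqu => /eqP e; rewrite -(psK z) e psK.
  have zN := ps_lt z.
  (* The outer arc runs through the end of the cycle, so positions before [i] are reached one full
     turn later. *)
  have [k kin <-] : exists2 k, j < k < #|F| + i & w k = z.
    have [jz|zj'] := ltnP j (ps z); first by exists (ps z); rewrite ?psK //; lia.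
    exists (#|F| + ps z); first by lia.
    by rewrite (walkD_period _ oN wN) psK.
  have -> : k = j.+1 + (k - j.+1) by lia.
  apply: const => l lin; have [lN|Nl] := ltnP l #|F|; first by apply: w_ne; lia.
  have -> : l = #|F| + (l - #|F|) by lia.
  by rewrite (walkD_period _ oN wN); apply: w_ne; lia.
have qyu : q y != u.
  by apply/eqP => e; move: yin; rewrite /j -e qK ltnn andbF.
have qyqu : q y != q u.
  by apply/eqP => /(can_inj qK) e; move: yin; rewrite /i -e ltnn.
(* The supposed crossing chord from [y] to [q y] joins the two arcs and [J] is invariant under [q],
   so [J] is constant away from [u] and [q u]. Its value at [r u] is then false. *)
have allJ z : z != u -> z != q u -> J z = J y.
  move=> zu zqu; have [/inJ//|zout] := boolP (i < ps z < j).
  by rewrite outJ // -(outJ (q y)) // Jq.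
have JF z : z != u -> z != q u -> J z = false.
  move=> zu zqu; rewrite allJ // -nJ; symmetry; apply: allJ; first exact: fs_fpf2 fs _.
  by apply/eqP => e; have := fs_fpf12 fs u; rewrite e qK eqxx.
(* [J] holds at [p u], which forces [p u = q u]. Then [i] and [j] are consecutive positions, with no
   room for [y] between them. *)
have pu : p u = q u.
  apply/eqP; have := JF (p u) (pf u).
  by rewrite Jp /J connect0; case: eqP => // _ /(_ isT).
have ip : p (w i) = w j by rewrite !psK pu.
move: ip; rewrite walk_p //; case: ifP => _ /(congr1 ps); rewrite !wK //; lia.
Qed.

Notation O := (opener p q r A x0).

Definition openers i k := [set z | O z && (i <= ps z <= k)].
Definition closers i k := [set z | [&& z \in A, ~~ O z & i <= ps z <= k]].

Lemma closer_lt z : z \in A -> ~~ O z -> ps (q z) < ps z.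
Proof.
move=> zA; rewrite /opener zA /= -leqNgt leq_eqVlt => /orP[/eqP e|//].
by have := fs_fpf1 fs z; rewrite -{1}(psK (q z)) e psK eqxx.
Qed.

Lemma tree_mem_q z : (q z \in A) = (z \in A).
Proof. by have [-> _] := eclosedP fs A cA z. Qed.

Lemma opener_q z : z \in A -> O (q z) = ~~ O z.
Proof.
move=> zA; have [Oz|nO] := boolP (O z).
  by rewrite /opener tree_mem_q zA qK ltnNge ltnW //; case/andP: Oz.
by rewrite /opener tree_mem_q zA qK closer_lt.
Qed.

(** No chord leaves the interval spanned by the chord of [u], so [q] exchanges the openers and
    closers in it. *)
Lemma balanced_match u : O u ->
  #|openers (ps u) (ps (q u))| = #|closers (ps u) (ps (q u))|.
Proof.
move=> Ou; have /andP[uA lt] := Ou.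
have nin z : z \in A -> ps u <= ps z <= ps (q u) -> ps u <= ps (q z) <= ps (q u).
  move=> zA zin; have [e|/eqP zu] := eqVneq z u; first by rewrite e; lia.
  have [e|/eqP zqu] := eqVneq z (q u); first by rewrite e qK; lia.
  have neq v : z <> v -> ps z <> ps v by move=> zv /(congr1 w); rewrite !psK.
  have := neq _ zu; have := neq _ zqu; have := @noncrossing u z uA; lia.
apply/eqP; rewrite eqn_leq; apply/andP; split.
all: rewrite -[leqLHS](card_imset _ (can_inj qK)).
all: apply/subset_leq_card/subsetP => v /imsetP[z].
  rewrite inE => /andP[Oz zin] ->; have /andP[zA _] := Oz.
  by rewrite inE tree_mem_q zA opener_q // Oz /= nin.
by rewrite inE => /and3P[zA Oz zin] ->; rewrite inE opener_q // Oz nin.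
Qed.

(** Each closer met so far has its opener in the same stretch, and [u] itself is still unmatched. *)
Lemma unbalanced_before u k : O u -> ps u <= k < ps (q u) ->
  #|closers (ps u) k| < #|openers (ps u) k|.
Proof.
move=> Ou kin; have /andP[uA lt] := Ou.
rewrite -(card_imset (closers _ _) (can_inj qK)).
apply: proper_card; apply/properP; split; last first.
  exists u; first by rewrite inE Ou; lia.
  apply/imsetP => -[z]; rewrite inE => /and3P[zA nO zin] e.
  by move: kin; rewrite e qK; lia.
apply/subsetP => v /imsetP[z]; rewrite inE => /and3P[zA nO zin] ->.
rewrite inE opener_q // nO /=; have lt' := closer_lt zA nO.
have zu : ps z <> ps u.
  by move/(congr1 w); rewrite !psK => e; rewrite e Ou in nO.
by have := @noncrossing u z uA; lia.
Qed.

End Chords.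

(** The partner of an opener sits at the first position where the closers catch up with the openers,
    so the parenthesis word alone determines the chords. *)
Lemma chord_decode p q r A x0 p' q' r' A' x0' (s : F -> F) :
  flag_system p q r -> spanning_tree p q r A ->
  flag_system p' q' r' -> spanning_tree p' q' r' A' ->
  (forall k, s (walk p (cross q r A) x0 k) = walk p' (cross q' r' A') x0' k) ->
  (forall x, (s x \in A') = (x \in A)) ->
  (forall x, opener p' q' r' A' x0' (s x) = opener p q r A x0 x) ->
  {in A, forall u, s (q u) = q' (s u)}.
Proof.
move=> fs tr fs' tr' sw sA sO.
set ps := pos p (cross q r A) x0; set ps' := pos p' (cross q' r' A') x0'.
have [[cA _ conn] [cA' _ conn']] := (tr, tr').
have psK := tree_posK x0 fs tr; have ps_lt := tree_pos_lt x0 fs tr.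
have psK' := tree_posK x0' fs' tr'; have wK' := tree_walkK x0' fs' tr'.
rewrite -/ps -/ps' in psK ps_lt psK' wK'.
have ps_s x : ps' (s x) = ps x by rewrite -{1}(psK x) sw wK'.
have s_inj : injective s by move=> x y e; rewrite -(psK x) -ps_s e ps_s psK.
have s_onto y : s (walk p (cross q r A) x0 (ps' y)) = y by rewrite sw psK'.
have opE i k : openers p' q' r' A' x0' i k = s @: openers p q r A x0 i k.
  apply/setP => y; apply/idP/imsetP => [|[x + ->]]; rewrite inE; last first.
    by rewrite -/ps => H; rewrite inE sO -/ps' ps_s.
  rewrite -(s_onto y); set x := walk _ _ _ _; rewrite sO -/ps' ps_s => H.
  by exists x => //; rewrite inE.
have clE i k : closers p' q' r' A' x0' i k = s @: closers p q r A x0 i k.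
  apply/setP => y; apply/idP/imsetP => [|[x + ->]]; rewrite inE; last first.
    by rewrite -/ps => H; rewrite inE sA sO -/ps' ps_s.
  rewrite -(s_onto y); set x := walk _ _ _ _; rewrite sA sO -/ps' ps_s => H.
  by exists x => //; rewrite inE.
have main u : opener p q r A x0 u -> s (q u) = q' (s u).
  move=> Ou; have Ou' : opener p' q' r' A' x0' (s u) by rewrite sO.
  suff e : ps (q u) = ps' (q' (s u)) by rewrite -(psK' (q' (s u))) -e -sw psK.
  have B := balanced_match fs tr Ou; have B' := balanced_match fs' tr' Ou'.
  have U := unbalanced_before fs tr Ou.
  have U' := unbalanced_before fs' tr' Ou'.
  move: B' U'; rewrite -/ps -/ps' ps_s opE clE !card_imset // => B' U'.
  have /andP[_ lt] := Ou; have /andP[_ lt'] := Ou'.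
  rewrite -/ps -/ps' ps_s in lt lt' B U.
  (* At the earlier of the two partners one word would be balanced and the other not, although [s]
     carries one word to the other. *)
  case: (ltngtP (ps (q u)) (ps' (q' (s u)))) => // cmp.
    have := U' (ps (q u)); rewrite opE clE !card_imset // B ltnn; lia.
  have := U (ps' (q' (s u))); rewrite B' ltnn; lia.
move=> u uA; have [/main//|nO] := boolP (opener p q r A x0 u).
have := main (q u); rewrite (opener_q x0 fs tr uA) nO (fsK1 fs) => /(_ isT) e.
by rewrite e (fsK1 fs').
Qed.

End Tree.

(** * Codes of maps *)

Section Code.
Variable F : finType.
Implicit Types (a : F -> F) (T S R X : {set F}).

Lemma eclosed_swap (q r : F -> F) X : eclosed q r X -> eclosed r q X.
Proof. by move=> /forallP c; apply/forallP => x; rewrite andbC. Qed.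

(** The contour around [T] uses [a1], [a0] on [T], and [a2] off [T]. All of these are steps of the
    dual subgraph [~: T], which is therefore connected and contains a spanning tree of the dual. *)
Lemma tree_cotree a0 a1 a2 : flag_system a1 a2 a0 ->
  (forall x y, connect (step3 a1 a2 a0 setT) x y) ->
  exists T S, [/\ spanning_tree a1 a2 a0 T, spanning_tree a1 a0 a2 S,
    S \subset ~: T, 4 * ncomp (step3 a1 a2 a0 set0) <= 4 + #|T| &
    4 * ncomp (step3 a1 a0 a2 set0) <= 4 + #|S|].
Proof.
move=> fs conn; have fs' := flag_system_swap fs.
have cT : eclosed a2 a0 [set: F] by apply/forallP => x; rewrite !inE.
have [T [_ trT nT]] := spanning_tree_exists fs cT conn.
have [eT _ connT] := trT.
have cC : eclosed a0 a2 (~: T) by apply/eclosed_swap/(eclosedC fs).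
have [|S [ST trS nS]] := spanning_tree_exists fs' cC; last by exists T, S.
move=> x y; apply: connect_sub (connT x y) => {}x {}y /orP[] /eqP->.
  exact: connect3_p.
rewrite /cross; case: ifP => xT; first exact: connect3_q.
by apply: connect3_r; rewrite inE xT.
Qed.

Lemma edge_representatives (p q r : F -> F) X : flag_system p q r -> eclosed q r X ->
  exists R, [/\ R \subset X, 4 * #|R| = #|X| &
    forall x, x \in X -> exists2 u, u \in R & x \in edge q r u].
Proof.
move=> fs; elim: {X}_.+1 {-2}X (ltnSn #|X|) => // n IH X Xn cX.
have [->|/set0Pn[u uX]] := eqVneq X set0.
  by exists set0; split=> [||x]; rewrite ?cards0 ?inE.
have EX := edge_sub fs cX uX; have cE := eclosed_edge fs u.
have cardX : #|X| = 4 + #|X :\: edge q r u|.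
  by rewrite -(cardsID (edge q r u) X) (setIidPr EX) (card_edge fs).
have [||R [RX cR Rcov]] := IH (X :\: edge q r u); [lia | exact: (eclosedD fs cX cE) | ].
exists (u |: R); split.
- by rewrite subUset sub1set uX (subset_trans RX) // subsetDl.
- rewrite cardsU1 cardX -cR; suff -> : u \notin R by lia.
  by apply/negP => /(subsetP RX); rewrite in_setD edge_id.
- move=> x xX; have [xE|xE] := boolP (x \in edge q r u).
    by exists u => //; rewrite setU11.
  have [|v vR xv] := Rcov x; first by rewrite in_setD xE.
  by exists v => //; rewrite setU1r.
Qed.

Variable x0 : F.
Variable h : nat.
Notation N := #|F|.
Notation index_set := {set 'I_N}.

(* In order: the tree, the cotree, representatives of the remaining edges, the openers
   on the two contours, and the endpoints of the remaining edges. *)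
Definition code : finType :=
  (index_set * index_set * index_set * index_set * index_set * h.-tuple 'I_(4 * h).+1)%type.

Definition contour a0 a1 a2 T := walk a1 (cross a2 a0 T) x0.
Definition cpos a0 a1 a2 T := pos a1 (cross a2 a0 T) x0.
Definition places (P : pred nat) := [seq k <- iota 0 N | P k].

(** Flags are named by their positions on the contour around [T], except that the openers of the
    cotree are recorded on the contour around [S]. In [cd_g] the rank of [x] among the
    representatives selects a tuple entry, which is the rank of [a0 x] among the flags outside [T]
    and [S]. *)
Record coded a0 a1 a2 (c : code) T S R : Prop := Coded {
  cd_T : spanning_tree a1 a2 a0 T;
  cd_S : spanning_tree a1 a0 a2 S;
  cd_ST : S \subset ~: T;
  cd_RX : R \subset ~: (T :|: S);
  cd_cov : forall x, x \in ~: (T :|: S) -> exists2 u, u \in R & x \in edge a2 a0 u;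
  cd_cT : forall k : 'I_N, (k \in c.1.1.1.1.1) = (contour a0 a1 a2 T k \in T);
  cd_cS : forall k : 'I_N, (k \in c.1.1.1.1.2) = (contour a0 a1 a2 T k \in S);
  cd_cR : forall k : 'I_N, (k \in c.1.1.1.2) = (contour a0 a1 a2 T k \in R);
  cd_cO : forall k : 'I_N, (k \in c.1.1.2) = opener a1 a2 a0 T x0 (contour a0 a1 a2 T k);
  cd_cO' : forall k : 'I_N, (k \in c.1.2) = opener a1 a0 a2 S x0 (contour a2 a1 a0 S k);
  cd_g : forall x, x \in R -> cpos a0 a1 a2 T (a0 x) =
    nth 0 (places (fun k => contour a0 a1 a2 T k \in ~: (T :|: S)))
      (nth ord0 c.2 (index (cpos a0 a1 a2 T x) (places (fun k => contour a0 a1 a2 T k \in R)))) }.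

(** The numerical hypothesis is Euler's formula times four, as an inequality. The two trees miss at
    most [h] edges, because their sizes are bounded below by the numbers of vertices and faces, each
    less one. *)
Lemma coded_exists a0 a1 a2 : flag_system a1 a2 a0 ->
  (forall x y, connect (step3 a1 a2 a0 setT) x y) ->
  N + 8 <= 4 * ncomp (step3 a1 a2 a0 set0) + 4 * ncomp (step3 a1 a0 a2 set0) + 4 * h ->
  exists c T S R, coded a0 a1 a2 c T S R.
Proof.
move=> fs conn Nh.
have [T [S [trT trS ST nT nS]]] := tree_cotree fs conn.
have eX : eclosed a2 a0 (~: (T :|: S)).
  have [cT _ _] := trT; have [/eclosed_swap cS _ _] := trS.
  by rewrite setCU -setDE; apply: (eclosedD fs _ cS); apply: (eclosedC fs).
have [R [RX cR Rcov]] := edge_representatives fs eX.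
have cardX : #|~: (T :|: S)| <= 4 * h.
  have := cardsC (T :|: S); rewrite cardsU.
  have -> : T :&: S = set0 by apply/eqP; rewrite setIC setI_eq0 disjoints_subset.
  by rewrite cards0 subn0; lia.
pose w := contour a0 a1 a2 T; pose ps := cpos a0 a1 a2 T.
have psK x : w (ps x) = x := tree_posK x0 fs trT x.
have ps_lt x : ps x < N := tree_pos_lt x0 fs trT x.
have wK k : k < N -> ps (w k) = k by apply: (tree_walkK x0 fs trT).
have size_places (P : {set F}) : size (places (fun k => w k \in P)) <= #|P|.
  rewrite cardE -(size_map ps); apply: uniq_leq_size; first exact/filter_uniq/iota_uniq.
  move=> k; rewrite mem_filter mem_iota /= add0n => /andP[kP kN].
  by apply/mapP; exists (w k); rewrite ?mem_enum ?wK.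
have mem_places (P : {set F}) x : x \in P -> ps x \in places (fun k => w k \in P).
  by move=> xP; rewrite mem_filter psK xP mem_iota ps_lt.
pose pR := places (fun k => w k \in R).
pose pX := places (fun k => w k \in ~: (T :|: S)).
(* Entries past the number of representatives are filler. An index is at most the length of [pX],
   hence at most [4 * h], so [(4 * h).+1] values suffice. *)
pose g : h.-tuple 'I_(4 * h).+1 :=
  [tuple inord (index (ps (a0 (w (nth 0 pR k)))) pX) | k < h].
exists ([set k : 'I_N | w k \in T], [set k : 'I_N | w k \in S], [set k : 'I_N | w k \in R],
        [set k : 'I_N | opener a1 a2 a0 T x0 (w k)],
        [set k : 'I_N | opener a1 a0 a2 S x0 (contour a2 a1 a0 S k)], g), T, S, R.
split=> //; try by move=> k; rewrite inE.
move=> x xR; rewrite -/w -/ps -/pR -/pX /=.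
have xpR : ps x \in pR by apply: mem_places.
have lt_h : index (ps x) pR < h.
  have Rh : #|R| <= h by rewrite -(@leq_pmul2l 4) // cR.
  by apply: leq_trans (leq_trans (size_places R) Rh); rewrite index_mem.
have -> : nth ord0 g (index (ps x) pR) = tnth g (Ordinal lt_h) by rewrite (tnth_nth ord0).
rewrite tnth_mktuple /= nth_index // psK inordK.
  rewrite nth_index //; apply: mem_places.
  by have [_ ->] := eclosedP fs _ eX x; apply: (subsetP RX).
by rewrite ltnS (leq_trans (index_size _ _)) // (leq_trans (size_places _)).
Qed.

(** The map [s] matches flags at equal positions on the two tree contours. The involutions are
    recovered in the order [a1], [a2], [a0] off the cotree, and finally [a0] on the cotree. *)
Lemma coded_inj a0 a1 a2 b0 b1 b2 c T S R T' S' R' :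
  flag_system a1 a2 a0 -> flag_system b1 b2 b0 ->
  coded a0 a1 a2 c T S R -> coded b0 b1 b2 c T' S' R' ->
  exists2 s : F -> F, injective s &
    forall x, [/\ s (a0 x) = b0 (s x), s (a1 x) = b1 (s x) & s (a2 x) = b2 (s x)].
Proof.
move=> fs fs' cd cd'.
have fsw := flag_system_swap fs; have fsw' := flag_system_swap fs'.
have trT := cd_T cd; have trT' := cd_T cd'; have trS := cd_S cd; have trS' := cd_S cd'.
have [cT _ _] := trT; have [cT' _ _] := trT'.
pose w := contour a0 a1 a2 T; pose ps := cpos a0 a1 a2 T.
pose w' := contour b0 b1 b2 T'; pose ps' := cpos b0 b1 b2 T'.
have psK x : w (ps x) = x := tree_posK x0 fs trT x.
have ps_lt x : ps x < N := tree_pos_lt x0 fs trT x.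
have wK k : k < N -> ps (w k) = k by apply: (tree_walkK x0 fs trT).
have psK' x : w' (ps' x) = x := tree_posK x0 fs' trT' x.
have wK' k : k < N -> ps' (w' k) = k by apply: (tree_walkK x0 fs' trT').
pose s x := w' (ps x).
have ps_s x : ps' (s x) = ps x by rewrite /s wK'.
have s_inj : injective s by move=> x y e; rewrite -(psK x) -ps_s e ps_s psK.
have transfer (P P' : pred F) (I : {set 'I_N}) : (forall k : 'I_N, (k \in I) = P (w k)) ->
    (forall k : 'I_N, (k \in I) = P' (w' k)) -> forall x, P' (s x) = P x.
  by move=> PI PI' x; rewrite /s -(PI' (Ordinal (ps_lt x))) PI /= psK.
have sT : forall x, (s x \in T') = (x \in T).
  exact: (transfer (mem T) (mem T') _ (cd_cT cd) (cd_cT cd')).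
have sS : forall x, (s x \in S') = (x \in S).
  exact: (transfer (mem S) (mem S') _ (cd_cS cd) (cd_cS cd')).
have sR : forall x, (s x \in R') = (x \in R).
  exact: (transfer (mem R) (mem R') _ (cd_cR cd) (cd_cR cd')).
have sO : forall x, opener b1 b2 b0 T' x0 (s x) = opener a1 a2 a0 T x0 x.
  exact: (transfer _ _ _ (cd_cO cd) (cd_cO cd')).
have swlt k : k < N -> s (w k) = w' k by move=> kN; rewrite /s wK.
have [|oN wN _ _] := walk_full (x0 := x0) (fsK0 fs) (crossK fs cT)
  (fs_fpf0 fs) (cross_fpf fs T).
  by case: trT => _ _ + x; apply.
have [|_ wN' _ _] := walk_full (x0 := x0) (fsK0 fs') (crossK fs' cT')
  (fs_fpf0 fs') (cross_fpf fs' T').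
  by case: trT' => _ _ + x; apply.
have N0 : 0 < N by apply/card_gt0P; exists x0.
have sw k : s (w k) = w' k.
  rewrite (divn_eq k N); elim: (k %/ N) => [|d IH]; first by rewrite add0n swlt // ltn_mod.
  by rewrite mulSn -addnA /w /w' /contour (walkD_period _ oN wN) (walkD_period _ oN wN') IH.
have s1 x : s (a1 x) = b1 (s x).
  have w1 := walk_p (cross a2 a0 T) x0 (fsK0 fs) (ps x).
  have w1' := walk_p (cross b2 b0 T') x0 (fsK0 fs') (ps x).
  rewrite -/(contour _ _ _ _) -/w in w1; rewrite -/(contour _ _ _ _) -/w' in w1'.
  by rewrite -(psK x) w1 !sw w1'.
have sb x : s (cross a2 a0 T x) = cross b2 b0 T' (s x).
  (* [walk_b] needs a positive position, so position 0 is replaced by [N], one full turn later. *)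
  have [k k0 ->] : exists2 k, 0 < k & x = w k.
    have [e|k0] := posnP (ps x); last by exists (ps x); rewrite ?psK.
    by exists N; rewrite // /w /contour wN -(psK x) e.
  have wb := walk_b a1 x0 (crossK fs cT) k0; rewrite -/(contour _ _ _ _) -/w in wb.
  have wb' := walk_b b1 x0 (crossK fs' cT') k0; rewrite -/(contour _ _ _ _) -/w' in wb'.
  by rewrite wb !sw wb'.
(* Off [T] the contour itself steps by [a2]; on [T] the chords are decoded from the parenthesis
   word. *)
have s2 x : s (a2 x) = b2 (s x).
  have [xT|xT] := boolP (x \in T); last by have := sb x; rewrite /cross sT (negPf xT).
  exact: (chord_decode (x0 := x0) (x0' := x0) fs trT fs' trT' sw sT sO).
(* The tuple gives [a0] at the representatives, and commutation with [a2] spreads it to the other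
   flags of their edges. *)
have s0X x : x \in ~: (T :|: S) -> s (a0 x) = b0 (s x).
  have s0R u : u \in R -> s (a0 u) = b0 (s u).
    move=> uR; have uR' : s u \in R' by rewrite sR.
    suff e : ps (a0 u) = ps' (b0 (s u)) by rewrite -[RHS]psK' -e.
    rewrite [LHS](cd_g cd uR) [RHS](cd_g cd' uR') -/w -/w' -/ps -/ps' ps_s.
    have eP (P P' : {set F}) : (forall x, (s x \in P') = (x \in P)) ->
        places (fun k => w k \in P) = places (fun k => w' k \in P').
      by move=> sP; apply: eq_filter => k; rewrite -sw sP.
    by rewrite (eP _ _ sR) (eP _ (~: (T' :|: S'))) // => y; rewrite !inE sT sS.
  case/(cd_cov cd) => u uR; rewrite !inE -!orbA.
  have e2 := s0R _ uR.
  case/or4P=> /eqP->; rewrite ?s2 //.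
  - by rewrite -(fsC fs) !s2 e2 (fsC fs').
  - by rewrite (fsK2 fs) e2 (fsK2 fs').
  - by rewrite (fsC fs) (fsK2 fs) e2 s2 (fsC fs') (fsK2 fs').
have s0nS x : x \notin S -> s (a0 x) = b0 (s x).
  move=> xS; have [xT|xT] := boolP (x \in T); first by have := sb x; rewrite /cross sT xT.
  by apply: s0X; rewrite !inE negb_or xT.
(* The cotree contour steps by [a2] on [S] and by [a0] off [S], and [s] already respects both, so it
   carries one cotree contour to the other. *)
have sb' x : s (cross a0 a2 S x) = cross b0 b2 S' (s x).
  by rewrite /cross sS; case: ifP => xS; rewrite ?s2 // s0nS ?xS.
have sw' k : s (contour a2 a1 a0 S k) = contour b2 b1 b0 S' k.
  elim: k => [|k IH]; first exact: (sw 0).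
  by rewrite /contour /=; case: ifP => _; rewrite ?sb' ?s1 IH.
have sO' x : opener b1 b0 b2 S' x0 (s x) = opener a1 a0 a2 S x0 x.
  have lt := tree_pos_lt x0 fsw trS x; rewrite -{1}[x](tree_posK x0 fsw trS).
  have := sw' (pos a1 (cross a0 a2 S) x0 x); rewrite {1}/contour => ->.
  rewrite -(cd_cO' cd' (Ordinal lt)) (cd_cO' cd) /= /contour.
  by rewrite (tree_posK x0 fsw trS).
have s0 x : s (a0 x) = b0 (s x).
  have [xS|/s0nS//] := boolP (x \in S).
  exact: (chord_decode (x0 := x0) (x0' := x0) fsw trS fsw' trS' sw' sS sO').
by exists s.
Qed.
End Code.

(** * Counting maps *)

Section Orbits.
Variable F : finType.
Implicit Types (A : {set {perm F}}) (e : rel F).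

(** The permutations sending every point to one reachable by [e] form a group that contains [A]. *)
Lemma orbit_gen_connect A e x y :
  (forall a z, a \in A -> connect e z (a z)) -> y \in orbit 'P <<A>> x -> connect e x y.
Proof.
move=> Ae /orbitP[g gA <-] /=.
pose H := [set g : {perm F} | [forall z, connect e z (g z)]].
have gH : group_set H.
  apply/group_setP; split; first by rewrite inE; apply/forallP => z; rewrite perm1.
  move=> a b; rewrite !inE => /forallP Ha /forallP Hb; apply/forallP => z.
  by rewrite permM (connect_trans (Ha z)).
have : <<A>>%g \subset Group gH.
  by rewrite gen_subG; apply/subsetP => a aA; rewrite inE; apply/forallP => z; apply: Ae.
by move/subsetP/(_ g gA); rewrite inE => /forallP/(_ x).
Qed.

Lemma orbit_gen2 (a b : {perm F}) x : orbit 'P <<[set a; b]>> x = component (step2 a b) x.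
Proof.
have step c z : c \in [set a; b] -> c z \in orbit 'P <<[set a; b]>> z.
  by move=> cA; apply/orbitP; exists c => //; apply: mem_gen.
apply/setP => y; rewrite inE; apply/idP/idP.
  by apply: orbit_gen_connect => c z; rewrite !inE => /orP[] /eqP->;
     [apply: connect_p | apply: connect_b].
move=> /connectP[s ps ->]; elim/last_ind: s ps => [|s z IH]; first by rewrite orbit_refl.
rewrite rcons_path last_rcons => /andP[/IH xs st].
apply: orbit_trans xs; case/orP: st => /eqP->; apply: step.
  exact: set21.
exact: set22.
Qed.

Lemma ncomp_orbits (a b c : {perm F}) :
  #|[set orbit 'P <<[set a; b]>> x | x : F]| = ncomp (step3 a b c set0).
Proof.
congr #|pred_of_set _|; apply: eq_imset => x; rewrite orbit_gen2.
apply/setP => y; rewrite !inE; apply: eq_connect => u v.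
by rewrite /step2 /step3 /= inE /= orbF.
Qed.

End Orbits.

(** * Vertices, edges and faces of a simple map *)

Section Map.
Variables (m : nat) (t : triple m).
Notation F := 'I_(4 * m).
Hypothesis mt : is_map t.

Lemma fpf_involutionP (a : {perm F}) : fpf_involution a ->
  involutive a /\ forall x, a x != x.
Proof.
case/andP=> /eqP aa /forallP fpf; split=> // x.
by rewrite -permM aa perm1.
Qed.

Lemma map_flag_system : flag_system (al1 t) (al2 t) (al0 t).
Proof.
case/and5P: mt => /fpf_involutionP[K0 f0] /fpf_involutionP[K1 f1].
move=> /fpf_involutionP[K2 f2] /eqP C /andP[/forallP f02 _].
have C' x : al2 t (al0 t x) = al0 t (al2 t x) by rewrite -!permM C.
by split=> // x; rewrite C'.
Qed.

Lemma map_connected x y : connect (step3 (al1 t) (al2 t) (al0 t) setT) x y.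
Proof.
case/and5P: mt => _ _ _ _ /andP[_ /atransP/(_ x)]; rewrite inE => /(_ isT) orb.
apply: (@orbit_gen_connect _ [set al0 t; al1 t; al2 t]); last by rewrite orb inE.
move=> a z; rewrite !inE -orbA => /or3P[] /eqP->.
- by apply: connect3_r; rewrite inE.
- exact: connect3_p.
- exact: connect3_q.
Qed.

Lemma nvertsE : nverts t = ncomp (step3 (al1 t) (al2 t) (al0 t) set0).
Proof. exact: ncomp_orbits. Qed.

Lemma nfacesE : nfaces t = ncomp (step3 (al1 t) (al0 t) (al2 t) set0).
Proof. by rewrite -ncomp_orbits /nfaces /face_of setUC. Qed.

Lemma edge_of_sub x : edge_of t x \subset edge (al2 t) (al0 t) x.
Proof.
have fs := map_flag_system.
apply/subsetP => y; rewrite /edge_of orbit_gen2 inE => /connectP[s ps ->].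
elim/last_ind: s ps => [|s z IH]; first by rewrite edge_id.
rewrite rcons_path last_rcons => /andP[/IH xs].
have [c2 c0] := eclosedP fs _ (eclosed_edge fs x) (last x s).
by case/orP=> /eqP->; rewrite ?c0 ?c2.
Qed.

Lemma leq_nedges : m <= nedges t.
Proof.
have fs := map_flag_system.
suff : 4 * m <= nedges t * 4 by lia.
rewrite -[leqLHS]card_ord -cardsT.
have -> : [set: F] = cover [set edge_of t x | x : F].
  apply/setP => x; rewrite inE; symmetry; apply/bigcupP.
  by exists (edge_of t x); [apply: imset_f | apply: orbit_refl].
apply: leq_trans (leq_card_cover _) _; rewrite -sum_nat_const.
apply: leq_sum => C /imsetP[x _ ->]; apply: leq_trans (subset_leq_card (edge_of_sub x)) _.
by rewrite (card_edge fs).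
Qed.

Lemma vertex_al1 x : vertex_of t (al1 t x) = vertex_of t x.
Proof. by apply/orbit_eqP/orbitP; exists (al1 t) => //; apply/mem_gen/set21. Qed.

Lemma vertex_al2 x : vertex_of t (al2 t x) = vertex_of t x.
Proof. by apply/orbit_eqP/orbitP; exists (al2 t) => //; apply/mem_gen/set22. Qed.

Hypothesis st : simple_map t.

(** Five flags around [x] in its face are distinct. The delicate case is a digon, where
    [a1 (a0 x) = a0 (a1 x)]. *)
Lemma card_face x : 1 < m -> 4 < #|face_of t x|.
Proof.
move=> m1; have fs := map_flag_system.
have [K1 K2 K0 C f1 f2 f0 f20] := fs.
case/andP: st => /forallP noloop /forallP simple.
pose a0 := al0 t; pose a1 := al1 t; pose a2 := al2 t.
have ne01 z : a0 z != a1 z.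
  by apply: contra (noloop z) => /eqP e; rewrite -/a0 e vertex_al1.
have ne : a1 (a0 x) != a0 (a1 x).
  apply/eqP => e.
  (* In a digon the edges of [x] and [a1 x] join the same vertices, so simplicity makes them one
     edge. *)
  have /forallP/(_ (a1 x))/implyP := simple x.
  rewrite -[al0 t (a1 x)]/(a0 (a1 x)) -e !vertex_al1 => /(_ (eqxx _)) /eqP ee.
  have : a1 x \in edge a2 a0 x.
    by apply: (subsetP (edge_of_sub x)); rewrite ee; apply: orbit_refl.
  rewrite !inE (negPf (f1 x)) (eq_sym _ (a0 x)) (negPf (ne01 x)) /= orbF => /orP[/eqP e12|/eqP e12].
    (* Here the four flags of the edge are closed under [a1], so the connected map is a single edge,
       against [1 < m]. *)
    have e12' : a1 (a0 x) = a2 (a0 x) by rewrite e e12 -C.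
    have clE := eclosedP fs _ (eclosed_edge fs x).
    have E1 z : z \in edge a2 a0 x -> a1 z \in edge a2 a0 x.
      have K12 : a1 (a2 x) = x by rewrite -e12 K1.
      have K12' : a1 (a2 (a0 x)) = a0 x by rewrite -e12' K1.
      rewrite !inE -!orbA => /or4P[] /eqP->; rewrite ?K12 ?K12' ?e12 ?e12' ?eqxx ?orbT //.
    have full y : y \in edge a2 a0 x.
      have /connectP[s ps ->] := map_connected x y.
      elim/last_ind: s ps => [|s z IH]; first by rewrite edge_id.
      rewrite rcons_path last_rcons => /andP[/IH xs].
      have [c2 c0] := clE (last x s).
      by case/or3P=> [||/andP[_]] /eqP->; rewrite ?c0 ?c2 // E1.
    have : #|[set: F]| <= #|edge a2 a0 x| by apply/subset_leq_card/subsetP.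
    by rewrite cardsT card_ord (card_edge fs); lia.
  (* Here [a1 x = a2 (a0 x)] puts both ends of the edge at one vertex: a loop. *)
  have := noloop x; rewrite -/a0 -(vertex_al2 (a0 x)) -[al2 t _]/(a2 (a0 x)) -e12.
  by rewrite vertex_al1 eqxx.
have mem0 y : y \in face_of t x -> a0 y \in face_of t x.
  by move=> yx; apply: orbit_trans yx; apply/orbitP; exists a0 => //; apply/mem_gen/set21.
have mem1 y : y \in face_of t x -> a1 y \in face_of t x.
  by move=> yx; apply: orbit_trans yx; apply/orbitP; exists a1 => //; apply/mem_gen/set22.
have xx : x \in face_of t x by apply: orbit_refl.
pose s := [:: x; a0 x; a1 x; a1 (a0 x); a0 (a1 x)].
have us : uniq s.
  have n1 z : z != a1 (a0 z) by rewrite -(inj_eq (can_inj K1)) K1 eq_sym ne01.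
  have n2 z : z != a0 (a1 z) by rewrite -(inj_eq (can_inj K0)) K0 ne01.
  rewrite /= !inE !negb_or !andbT.
  rewrite (eq_sym x) f0 (eq_sym x) f1 n1 n2 ne01 (eq_sym (a0 x)) f1.
  rewrite (inj_eq (can_inj K0)) (eq_sym x) f1 (inj_eq (can_inj K1)) (eq_sym x) f0.
  by rewrite (eq_sym (a1 x)) f0 ne.
apply: (@leq_trans (size s)) => //; rewrite cardE.
apply: uniq_leq_size => // y; rewrite mem_enum !inE.
by case/or4P=> [|||/orP[]] /eqP->; rewrite ?(mem0, mem1).
Qed.

Lemma leq_nfaces : 1 < m -> nfaces t * 5 <= 4 * m.
Proof.
move=> m1; rewrite -[leqRHS]card_ord -cardsT.
have P : partition [set face_of t x | x : F] setT.
  have <- : [set face_of t x | x in [set: F]] = [set face_of t x | x : F].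
    by apply/setP => C; apply/imsetP/imsetP => -[x _ ->]; exists x; rewrite ?inE.
  by apply: orbit_partition; apply/actsP => a _ x; rewrite !inE.
rewrite (card_partition P) -sum_nat_const.
by apply: leq_sum => C /imsetP[x _ ->]; apply: card_face.
Qed.

End Map.

(** * The number of codes and the final estimate *)

Lemma card_code (F : finType) h : #|code F h| = 2 ^ (5 * #|F|) * (4 * h).+1 ^ h.
Proof.
rewrite /code !card_prod card_tuple !card_ord; congr (_ * _).
have -> : #|{: {set 'I_#|F|}}| = 2 ^ #|F|.
  by rewrite -[LHS]cardsT -powersetT card_powerset cardsT card_ord.
by rewrite -!expnD; congr (2 ^ _); lia.
Qed.

Lemma iso_class_eq m (t u : triple m) : map_iso t u ->
  [set v | map_iso t v] = [set v | map_iso u v].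
Proof.
case/existsP=> s /eqP ->; apply/setP => v; rewrite !inE.
apply/existsP/existsP => -[g /eqP->].
  by exists (s^-1 * g)%g; rewrite /al0 /al1 /al2 /= -!conjgM mulKVg.
by exists (s * g)%g; rewrite /al0 /al1 /al2 /= !conjgM.
Qed.

(** Maps with equal codes are isomorphic by [coded_inj], so there are at most as many classes as
    codes. The boolean factor records that no such map has more than [5 * (n + h)] edges. *)
Lemma card_iso_classes m n h o : 0 < n ->
  #|iso_classes m n h o| <= (m <= 5 * (n + h)) * (2 ^ (5 * (4 * m)) * (4 * h).+1 ^ h).
Proof.
move=> n0; rewrite /iso_classes; set D := simple_maps_in m n h o.
have [->|/set0Pn[t0 t0D]] := eqVneq D set0; first by rewrite imset0 cards0.
have DP t : t \in D -> [/\ is_map t, simple_map t, nverts t = n &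
    n + nfaces t + h = 2 + nedges t].
  rewrite inE => /and5P[mt st /eqP nt /eqP ht _]; split=> //.
  by rewrite -ht nt.
have -> : m <= 5 * (n + h).
  have [mt st nt ht] := DP t0 t0D; have := leq_nedges mt.
  have [m1|m1] := leqP m 1; first by lia.
  (* Euler's formula and [nfaces t * 5 <= 4 * m] give [m + 10 <= 5 * (n + h)]. *)
  have := leq_nfaces mt st m1; lia.
rewrite mul1n.
(* A vertex is the orbit of some flag, so [0 < n] provides the base flag of the contours. *)
have [x0 _] : exists x0 : 'I_(4 * m), x0 \in [set: 'I_(4 * m)].
  have [_ _ nt _] := DP t0 t0D; move: n0; rewrite -nt /nverts => /card_gt0P[C].
  by case/imsetP=> x _ _; exists x; rewrite inE.
have [f fP] : exists f : triple m -> code 'I_(4 * m) h, forall t, t \in D ->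
    exists T S R, coded x0 (al0 t) (al1 t) (al2 t) (f t) T S R.
  apply: (@fin_all_exists _ (fun _ => code 'I_(4 * m) h) (fun t c => t \in D ->
    exists T S R, coded x0 (al0 t) (al1 t) (al2 t) c T S R)) => t.
  have [tD|tD] := boolP (t \in D); last first.
    by exists (set0, set0, set0, set0, set0, [tuple ord0 | _ < h]).
  have [mt st nt ht] := DP t tD.
  have [||c [T [S [R cd]]]] := @coded_exists _ x0 h _ _ _ (map_flag_system mt).
  - exact: map_connected.
  - rewrite card_ord -nvertsE -nfacesE nt; have := leq_nedges mt; lia.
  by exists c => _; exists T, S, R.
apply: leq_trans (_ : #|f @: D| <= _); last first.
  by rewrite (leq_trans (max_card _)) // card_code card_ord.
apply: leq_card_imset_factor => t u tD uD e.
have [T [S [R cd]]] := fP t tD; have [T' [S' [R' cd']]] := fP u uD.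
have [mt _ _ _] := DP t tD; have [mu _ _ _] := DP u uD.
rewrite -e in cd'.
have [s s_inj sP] := coded_inj (map_flag_system mt) (map_flag_system mu) cd cd'.
apply: iso_class_eq; apply/existsP; exists (perm s_inj).
have conjE (a b : {perm 'I_(4 * m)}) : (forall x, s (a x) = b (s x)) ->
    b = (a ^ perm s_inj)%g.
  move=> ab; apply/permP => y; rewrite -[y](permKV (perm s_inj)); set x := (X in perm s_inj X).
  by rewrite permJ !permE ab.
rewrite -(conjE (al0 t) (al0 u)); last by move=> x; have [] := sP x.
rewrite -(conjE (al1 t) (al1 u)); last by move=> x; have [] := sP x.
rewrite -(conjE (al2 t) (al2 u)); last by move=> x; have [] := sP x.
by case: (u) => -[].
Qed.

Lemma sum_truncated_leq (f : nat -> nat) M L B :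
  (forall m, f m <= (m <= L) * B) -> \sum_(m < M) f m <= L.+1 * B.
Proof.
move=> fB; apply: leq_trans (_ : minn M L.+1 * B <= _); last by rewrite leq_mul2r geq_minr orbT.
elim: M => [|M IH]; first by rewrite big_ord0.
rewrite big_ord_recr /=; apply: leq_trans (leq_add IH (fB M)) _.
rewrite -mulnDl leq_mul2r; apply/orP; right; case: leqP; lia.
Qed.

Theorem theorem7 :
  exists c n0 : nat, forall (n h : nat) (o : bool),
    n0 <= n -> surface_exists h o ->
    num_simple_maps n h o <= c ^ (n + h) * h ^ h.
Proof.
(* With [L = 5 * (n + h)], the exponent collects [20 * L] from the sets in a code, [L] from the
   number of values of [m], and [3 * (n + h)] from the tuple: [21 * 5 + 3 = 108]. The threshold 1
   guarantees a base flag. *)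
exists (2 ^ 108), 1 => n h o n0 _.
set L := 5 * (n + h).
apply: leq_trans (_ : L.+1 * (2 ^ (20 * L) * (4 * h).+1 ^ h) <= _).
  apply: (@sum_truncated_leq (fun m => #|iso_classes m n h o|)) => m.
  apply: leq_trans (card_iso_classes m h o n0) _.
  case: (leqP m L) => mL; rewrite ?mul0n // !mul1n leq_mul2r leq_exp2l //.
  by apply/orP; right; lia.
have hh : (4 * h).+1 ^ h <= 2 ^ (3 * (n + h)) * h ^ h.
  (* For [h = 0] both [h]-th powers are 1; for positive [h], [(4 * h).+1 <= 8 * h]. *)
  case: (posnP h) => [->|h0]; first by rewrite !expn0 muln1 expn_gt0.
  apply: leq_trans (_ : (8 * h) ^ h <= _); first by rewrite leq_exp2r //; lia.
  rewrite expnMn leq_mul2r; apply/orP; right.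
  by rewrite -[8]/(2 ^ 3) -expnM leq_exp2l //; lia.
have LL : L.+1 <= 2 ^ L by apply: ltn_expl.
apply: leq_trans (leq_mul LL (leq_mul (leqnn _) hh)) _.
rewrite !mulnA -!expnD -expnM leq_mul2r leq_exp2l //; apply/orP; right.
rewrite /L; lia.
Qed.
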